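(* Let $t_n$ ($n\ge1$) be the number of rows with the value ''true'' in the Kleene truth tables of all bracketed formulae with $n$ distinct variables $p_1,\dots,p_n$ connected by implication. Then the generating function $T(x)=\sum_{n\ge1}t_nx^n$ is $$T(x)=\frac{4-\sqrt{1-12x}-\sqrt{5+24x+4\sqrt{1-12x}}}{6}.$$
   Context: Truth values are $1$ (true), $0$ (false), $2$ (unknown). The Kleene implication on $\{0,1,2\}$ is: $1\Rightarrow 1=1$, $1\Rightarrow 0=0$, $1\Rightarrow 2=2$; $0\Rightarrow b=1$ for every $b$; $2\Rightarrow 1=1$, $2\Rightarrow 0=2$, $2\Rightarrow 2=2$. A bracketed formula with $n$ distinct variables is a formula obtained from $p_1\Rightarrow p_2\Rightarrow\cdots\Rightarrow p_n$ by a complete bracketing (equivalently, a full binary tree with $n$ leaves labelled $p_1,\dots,p_n$ from left to right and every internal node labelled $\Rightarrow$); for $n=1$ the only one is $p_1$. A row of the truth table of such a formula is an assignment of $\{0,1,2\}$-values to $p_1,\dots,p_n$, and its value is the value of the formula under this assignment. Counting rows in all truth tables means counting pairs (bracketed formula, assignment). Generating functions are read as formal power series (equivalently, analytic functions near $0$), with $\sqrt{1-12x}$ the square root having constant term $1$ and $\sqrt{5+24x+4\sqrt{1-12x}}$ the square root having constant term $3$. *)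

(* Defs.v *)
From HB Require Import structures.
From mathcomp Require Import all_boot all_order all_algebra.
From mathcomp Require Import boolp classical_sets.

Set Implicit Arguments.
Unset Strict Implicit.
Unset Printing Implicit Defensive.

Import GRing.Theory.

Inductive kleene := KFalse | KTrue | KUnknown.

Definition kimp (a b : kleene) : kleene :=
  match a, b with
  | KTrue, _ => b
  | KFalse, _ => KTrue
  | KUnknown, KTrue => KTrue
  | KUnknown, _ => KUnknown
  end.

Definition kleene_code (a : kleene) : option bool :=
  match a with KFalse => Some false | KTrue => Some true | KUnknown => None end.

Definition kleene_decode (o : option bool) : kleene :=
  match o with Some false => KFalse | Some true => KTrue | None => KUnknown end.

Lemma kleene_codeK : cancel kleene_code kleene_decode.
Proof. by case. Qed.

HB.instance Definition _ := Finite.copy kleene (can_type kleene_codeK).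

Inductive formula (V : Type) := Var of V | Imp of formula V & formula V.

Section FormulaTheory.
Variable V : Type.

Fixpoint leaves (f : formula V) : seq V :=
  match f with Var v => [:: v] | Imp f g => leaves f ++ leaves g end.

Fixpoint eval (rho : V -> kleene) (f : formula V) : kleene :=
  match f with Var v => rho v | Imp f g => kimp (eval rho f) (eval rho g) end.

Fixpoint formula_tree (f : formula V) : GenTree.tree V :=
  match f with
  | Var v => GenTree.Leaf v
  | Imp f g => GenTree.Node 0 [:: formula_tree f; formula_tree g]
  end.

Fixpoint tree_formula (t : GenTree.tree V) : option (formula V) :=
  match t with
  | GenTree.Leaf v => Some (Var v)
  | GenTree.Node _ [:: t; u] =>
      if (tree_formula t, tree_formula u) is (Some f, Some g)
      then Some (Imp f g) else None
  | _ => None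
  end.

Lemma formula_treeK : pcancel formula_tree tree_formula.
Proof. by elim=> [//|f IHf g IHg] /=; rewrite IHf IHg. Qed.

Lemma leaves_gt0 (f : formula V) : 0 < size (leaves f).
Proof. by elim: f => //= f IHf g _; rewrite size_cat ltn_addr. Qed.

End FormulaTheory.

HB.instance Definition _ (V : countType) :=
  Countable.copy (formula V) (pcan_type (@formula_treeK V)).

(* The variables p_1, ..., p_n are the elements of 'I_n, and a bracketed formula
   is a formula whose leaves, read from left to right, are p_1, ..., p_n. *)
Definition is_bracketed n (f : formula 'I_n) : bool := leaves f == enum 'I_n.

Record bracketed n := Bracketed {
  bformula :> formula 'I_n;
  bformulaP : is_bracketed bformula
}.

HB.instance Definition _ n := [isSub for @bformula n].
HB.instance Definition _ n := [Countable of bracketed n by <:].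

Section BracketedFinite.
Variable n : nat.

Fixpoint formulas_upto (d : nat) : seq (formula 'I_n) :=
  if d is d'.+1 then
    map (@Var _) (enum 'I_n) ++
    [seq Imp f g | f <- formulas_upto d', g <- formulas_upto d']
  else [::].

Lemma mem_formulas_upto d f : size (leaves f) <= d -> f \in formulas_upto d.
Proof.
elim: d f => [|d IHd] [v|f g] //=.
- by rewrite size_cat leqNgt ltn_addr ?leaves_gt0.
- by move=> _; rewrite mem_cat map_f ?mem_enum.
rewrite size_cat mem_cat => le_d; apply/orP; right.
apply/allpairsP; exists (f, g); split=> //=; apply: IHd; rewrite -ltnS.
  by apply: leq_trans le_d; rewrite -addn1 leq_add2l leaves_gt0.
by apply: leq_trans le_d; rewrite -add1n leq_add2r leaves_gt0.
Qed.

Definition bracketed_enum : seq (bracketed n) :=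
  undup (pmap insub (formulas_upto n)).

Lemma mem_bracketed_enum f : f \in bracketed_enum.
Proof.
rewrite mem_undup mem_pmap_sub mem_formulas_upto //.
by rewrite (eqP (bformulaP f)) size_enum_ord.
Qed.

HB.instance Definition _ :=
  isFinite.Build (bracketed n)
    (Finite.uniq_enumP (undup_uniq _) mem_bracketed_enum).

End BracketedFinite.

Definition true_rows n : nat :=
  #|[set r : bracketed n * {ffun 'I_n -> kleene} | eval r.2 r.1 == KTrue]|.

Local Open Scope ring_scope.

Record fps (R : Type) := FPS { coefs :> nat -> R }.

Lemma fpsP (R : Type) (f g : fps R) : (forall n, f n = g n) -> f = g.
Proof. by case: f g => [f] [g] /= /funext->. Qed.

HB.instance Definition _ (R : Type) := gen_eqMixin (fps R).
HB.instance Definition _ (R : Type) := gen_choiceMixin (fps R).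

Section FPSRing.
Variable R : comNzRingType.
Implicit Types f g h : fps R.

Definition fps_zero : fps R := FPS (fun=> 0).
Definition fps_one : fps R := FPS (fun n => (n == 0)%:R).
Definition fps_opp f : fps R := FPS (fun n => - f n).
Definition fps_add f g : fps R := FPS (fun n => f n + g n).
Definition fps_mul f g : fps R :=
  FPS (fun n => \sum_(i < n.+1) f i * g (n - i)%N).
Definition fps_scale (a : R) f : fps R := FPS (fun n => a * f n).

Lemma fps_addA : associative fps_add.
Proof. by move=> f g h; apply: fpsP => n /=; rewrite addrA. Qed.
Lemma fps_addC : commutative fps_add.
Proof. by move=> f g; apply: fpsP => n /=; rewrite addrC. Qed.
Lemma fps_add0 : left_id fps_zero fps_add.
Proof. by move=> f; apply: fpsP => n /=; rewrite add0r. Qed.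
Lemma fps_addN : left_inverse fps_zero fps_opp fps_add.
Proof. by move=> f; apply: fpsP => n /=; rewrite addNr. Qed.

HB.instance Definition _ :=
  GRing.isZmodule.Build (fps R) fps_addA fps_addC fps_add0 fps_addN.

Definition fps_trunc d f : {poly R} := \poly_(i < d) f i.

Lemma fps_mulE d f g n :
  (n < d)%N -> fps_mul f g n = (fps_trunc d f * fps_trunc d g)`_n.
Proof.
move=> lt_nd; rewrite coefM; apply: eq_bigr => i _; rewrite !coef_poly.
have ->: (i < d)%N by apply: leq_ltn_trans lt_nd; rewrite -ltnS.
by have ->: (n - i < d)%N by apply: leq_ltn_trans lt_nd; apply: leq_subr.
Qed.

Lemma fps_mulC : commutative fps_mul.
Proof.
by move=> f g; apply: fpsP => n; rewrite !(@fps_mulE n.+1) // mulrC.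
Qed.

Lemma fps_mulA : associative fps_mul.
Proof.
move=> f g h; apply: fpsP => n.
pose t := fps_trunc n.+1.
transitivity ((t f * (t g * t h))`_n); last first.
  rewrite mulrA coefM /=; apply: eq_bigr => i _.
  by rewrite coef_poly ltnS leq_subr -fps_mulE.
rewrite coefM /=; apply: eq_bigr => i _.
by rewrite coef_poly ltn_ord -(@fps_mulE n.+1) // ltnS leq_subr.
Qed.

Lemma fps_mul1 : left_id fps_one fps_mul.
Proof.
move=> f; apply: fpsP => n; rewrite /fps_mul /= big_ord_recl /= mul1r subn0.
by rewrite big1 ?addr0 // => i _; rewrite mul0r.
Qed.

Lemma fps_mulDl : left_distributive fps_mul fps_add.
Proof.
move=> f g h; apply: fpsP => n /=; rewrite -big_split.
by apply: eq_bigr => i _; rewrite mulrDl.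
Qed.

Lemma fps_one_neq0 : fps_one != fps_zero.
Proof.
apply/eqP => /(congr1 (fun f : fps R => f 0%N)) /= /eqP.
by rewrite oner_eq0.
Qed.

HB.instance Definition _ :=
  GRing.Zmodule_isComNzRing.Build (fps R)
    fps_mulA fps_mulC fps_mul1 fps_mulDl fps_one_neq0.

Lemma fps_scaleA a b f : fps_scale a (fps_scale b f) = fps_scale (a * b) f.
Proof. by apply: fpsP => n /=; rewrite mulrA. Qed.
Lemma fps_scale1 : left_id 1 fps_scale.
Proof. by move=> f; apply: fpsP => n /=; rewrite mul1r. Qed.
Lemma fps_scaleDr : right_distributive fps_scale +%R.
Proof. by move=> a f g; apply: fpsP => n /=; rewrite mulrDr. Qed.
Lemma fps_scaleDl f : {morph fps_scale^~ f : a b / a + b}.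
Proof. by move=> a b; apply: fpsP => n /=; rewrite mulrDl. Qed.

HB.instance Definition _ :=
  GRing.Zmodule_isLmodule.Build R (fps R)
    fps_scaleA fps_scale1 fps_scaleDr fps_scaleDl.

Definition fpsX : fps R := FPS (fun n => (n == 1)%:R).

(* The square root of f with constant term c: the series s with s ^+ 2 = f and
   s 0 = c, and 0 if there is none.  fps_sqrtP and fps_sqrt_uniq show that
   it exists and is unique as soon as c ^+ 2 = f 0 and c is invertible, over
   a field where 2 != 0. *)
Definition fps_sqrt (c : R) f : fps R :=
  xget 0 [set s : fps R | s ^+ 2 = f /\ s 0%N = c]%classic.

End FPSRing.

Section FPSSqrt.
Variable F : fieldType.
Implicit Types (f s : fps F) (c : F).

Lemma fps_sqr0 s : (s ^+ 2) 0%N = s 0%N ^+ 2.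
Proof. by rewrite expr2 [LHS]big_ord1. Qed.

Lemma fps_sqrS s n :
  (s ^+ 2) n.+1 = 2%:R * s 0%N * s n.+1 + \sum_(i < n) s i.+1 * s (n - i)%N.
Proof.
rewrite expr2 [LHS]big_ord_recl big_ord_recr /= subn0 subnn.
rewrite -mulrA mulr_natl mulr2n [s n.+1 * _]mulrC addrA addrAC -addrA.
by congr (_ + _); apply: eq_bigr => i _; rewrite subSS.
Qed.

Fixpoint fps_sqrt_seq c f n : seq F :=
  if n is n'.+1 then
    let s := fps_sqrt_seq c f n' in
    rcons s ((f n'.+1 - \sum_(i < n') s`_i.+1 * s`_(n' - i)) / (2%:R * c))
  else [:: c].

Lemma size_fps_sqrt_seq c f n : size (fps_sqrt_seq c f n) = n.+1.
Proof. by elim: n => //= n IHn; rewrite size_rcons IHn. Qed.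

Lemma fps_sqrt_seq_nth c f n m i : (i <= n)%N -> (n <= m)%N ->
  (fps_sqrt_seq c f m)`_i = (fps_sqrt_seq c f n)`_i.
Proof.
move=> le_in; elim: m => [|m IHm]; first by rewrite leqn0 => /eqP->.
rewrite leq_eqVlt => /predU1P[-> //|le_nm] /=.
by rewrite nth_rcons size_fps_sqrt_seq ltnS (leq_trans le_in) ?IHm.
Qed.

Lemma fps_sqrt_ex c f : 2%:R != 0 :> F -> c != 0 -> c ^+ 2 = f 0%N ->
  exists s, s ^+ 2 = f /\ s 0%N = c.
Proof.
move=> nz2 nzc Dc; pose s := FPS (fun n => (fps_sqrt_seq c f n)`_n).
exists s; split=> //; apply: fpsP => -[|n]; first by rewrite fps_sqr0.
rewrite fps_sqrS /= nth_rcons size_fps_sqrt_seq ltnn eqxx.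
rewrite [_ * c * _]mulrC divfK ?mulf_neq0 //.
rewrite [X in _ - X](_ : _ = \sum_(i < n) s i.+1 * s (n - i)%N) ?subrK //.
apply: eq_bigr => i _; congr (_ * _); apply: fps_sqrt_seq_nth => //.
exact: leq_subr.
Qed.

Lemma fps_sqrt_inj s1 s2 : 2%:R != 0 :> F -> s1 0%N != 0 ->
  s1 ^+ 2 = s2 ^+ 2 -> s1 0%N = s2 0%N -> s1 = s2.
Proof.
move=> nz2 nzc eq_sqr eq0; apply: fpsP => n.
elim/ltn_ind: n => -[|n] IHn //.
have := congr1 (fun f : fps F => f n.+1) eq_sqr; rewrite !fps_sqrS -eq0.
rewrite [X in _ + X = _ -> _](_ : _ = \sum_(i < n) s2 i.+1 * s2 (n - i)%N).
  by move=> /addIr /mulfI->; rewrite ?mulf_neq0.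
by apply: eq_bigr => i _; rewrite !IHn // ltnS ?leq_subr.
Qed.

Lemma fps_sqrtP c f : 2%:R != 0 :> F -> c != 0 -> c ^+ 2 = f 0%N ->
  fps_sqrt c f ^+ 2 = f /\ fps_sqrt c f 0%N = c.
Proof. by move=> nz2 nzc Dc; exact: xgetPex (fps_sqrt_ex nz2 nzc Dc). Qed.

Lemma fps_sqrt_uniq c f s : 2%:R != 0 :> F -> c != 0 ->
  s ^+ 2 = f -> s 0%N = c -> fps_sqrt c f = s.
Proof.
move=> nz2 nzc Ds s0; apply: xget_unique => // u [Du u0].
by apply: fps_sqrt_inj; rewrite ?Du ?Ds ?u0 ?s0.
Qed.

End FPSSqrt.

Definition true_rows_gf : fps rat :=
  FPS (fun n => if (1 <= n)%N then (true_rows n)%:R else 0).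

(* Main.v *)
Require Import Defs.
From mathcomp Require Import all_boot all_order all_algebra.
From mathcomp Require Import ring.

Set Implicit Arguments.
Unset Strict Implicit.
Unset Printing Implicit Defensive.

Import GRing.Theory.
Local Open Scope ring_scope.

(* Substituting the truth values for the variables turns a row into a bracketed
   formula whose leaves are truth values.  Splitting such formulas at the root,
   the generating functions A, T, F of all rows, of the true rows and of the
   false rows satisfy
     A = 3x + A^2,   F = x + T F,   T = x + F A + (A - F) T.
   Eliminating F and cancelling the invertible factor 1 - A leaves
     3 T (1 - T) = A (1 + A - 2 T),
   a quadratic equation for T over Q[A], where 1 - 2 A = sqrt (1 - 12 x). *)

(** * Relabelling the leaves of a formula *)

Fixpoint map_formula (V W : Type) (h : V -> W) (f : formula V) : formula W :=
  match f with
  | Var v => Var (h v)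
  | Imp f g => Imp (map_formula h f) (map_formula h g)
  end.

Section FormulaShape.
Local Open Scope nat_scope.
Context {V W : eqType}.
Implicit Types h : V -> W.

Lemma leaves_map_formula h (f : formula V) : leaves (map_formula h f) = map h (leaves f).
Proof. by elim: f => //= f -> g ->; rewrite map_cat. Qed.

Lemma eval_map_formula (rho : W -> kleene) h (f : formula V) :
  eval rho (map_formula h f) = eval (rho \o h) f.
Proof. by elim: f => //= f -> g ->. Qed.

(** Relabelling keeps the shape, so equal images have left subformulas with equally many leaves. The
    common list of leaves is therefore cut at the same place on both sides, and induction applies to
    each half. *)
Lemma map_formula_inj (h h' : V -> W) f f' :
  map_formula h f = map_formula h' f' -> leaves f = leaves f' -> f = f'.
Proof.
elim: f f' => [v|f IHf g IHg] [v'|f' g'] //=; first by move=> _ [->].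
case=> eq_f eq_g /eqP; rewrite eqseq_cat; last first.
  by have /(congr1 (fun k => size (leaves k))) := eq_f;
     rewrite /= !leaves_map_formula !size_map.
by case/andP=> /eqP/(IHf _ eq_f)-> /eqP/(IHg _ eq_g)->.
Qed.

(** The shape of [f] is kept and [s] is distributed over it, cut at each node after as many entries
    as the left subformula has leaves. This yields surjectivity of the passage from rows to formulas
    over truth values. *)
Lemma formula_relabel (h : V -> W) (f : formula W) (s : seq V) :
  map h s = leaves f -> exists2 g, leaves g = s & map_formula h g = f.
Proof.
elim: f s => [w|f IHf g IHg] s /=.
  by case: s => [|v []] //= [<-]; exists (Var v).
move=> Ds; have := cat_take_drop (size (leaves f)) s.
have /eqP := Ds; rewrite -{1}[s](cat_take_drop (size (leaves f))) map_cat.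
rewrite eqseq_cat; last first.
  by rewrite map_take Ds take_size_cat.
case/andP=> /eqP/IHf[f' lf Df] /eqP/IHg[g' lg Dg] cats.
by exists (Imp f' g'); rewrite /= ?lf ?lg ?Df ?Dg.
Qed.

End FormulaShape.

(** * Enumeration of formulas by number of leaves *)

Section FormulaEnum.
Local Open Scope nat_scope.
Context {V : finType}.

(* [d] is fuel: the enumeration is complete when [n <= d]. *)
Fixpoint formulas_of_size (d n : nat) : seq (formula V) :=
  if (d, n) is (d'.+1, n'.+1) then
    (if n' == 0 then map (@Var V) (enum V) else [::]) ++
    [seq Imp p.1 p.2 | i <- iota 0 n',
       p <- [seq (f, g) | f <- formulas_of_size d' i.+1,
                          g <- formulas_of_size d' (n' - i)]]
  else [::].

Lemma formulas_of_sizeS d n :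
  formulas_of_size d.+1 n.+1 =
    (if n == 0 then map (@Var V) (enum V) else [::]) ++
    [seq Imp p.1 p.2 | i <- iota 0 n,
       p <- [seq (f, g) | f <- formulas_of_size d i.+1,
                          g <- formulas_of_size d (n - i)]].
Proof. by []. Qed.

Lemma mem_formulas_of_size d n f :
  n <= d -> (f \in formulas_of_size d n) = (size (leaves f) == n).
Proof.
elim: d n f => [|d IHd] [|n] f //=; rewrite ?ltnS => le_nd.
- by rewrite in_nil eqn0Ngt leaves_gt0.
- by rewrite in_nil eqn0Ngt leaves_gt0.
rewrite mem_cat; apply/orP/eqP => [[]|].
- by case: eqP => // -> /mapP[v _ ->].
- case/allpairsPdep => i [[g h]] [+ /allpairsP[[g' h']] [/= + + [-> ->]] ->].
  rewrite mem_iota add0n => /= lt_in.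
  rewrite !IHd ?(leq_trans (leq_subr _ _)) ?(leq_trans lt_in) //=.
  by move=> /eqP Dg /eqP Dh; rewrite size_cat Dg Dh addSn subnKC // ltnW.
case: f => [v [<-]|g h /=]; first by left; rewrite map_f ?mem_enum.
rewrite size_cat => sz; right; apply/allpairsPdep.
(* Both subformulas have a leaf, so the left one has [i.+1] leaves with [i < n], which leaves
   [n - i] for the right one. *)
have := leaves_gt0 g; have := leaves_gt0 h.
move: sz; case Dg: (size (leaves g)) => [|i] //; rewrite addSn => -[Dn] h0 _.
have lt_in : i < n by rewrite -Dn -addn1 leq_add2l.
exists i, (g, h); split=> //; first by rewrite mem_iota.
apply/allpairsP; exists (g, h).
by rewrite !IHd ?(leq_trans (leq_subr _ _)) ?(leq_trans lt_in) //= Dg -Dn addKn.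
Qed.

Lemma formulas_of_size_uniq d n : n <= d -> uniq (formulas_of_size d n).
Proof.
elim: d n => [|d IHd] [|n] //=; rewrite ltnS => le_nd.
case: eqP => [->|_] /=.
  by rewrite cats0 map_inj_uniq ?enum_uniq // => v w [].
apply: allpairs_uniq_dep => [|i|]; first exact: iota_uniq.
  rewrite mem_iota add0n => /= lt_in; apply: allpairs_uniq.
  - by rewrite IHd // (leq_trans lt_in).
  - by rewrite IHd // (leq_trans (leq_subr _ _)).
  by move=> [? ?] [].
(* The index [i] can be read off the formula, as its left subformula has [i.+1] leaves; hence blocks
   with different indices are disjoint. *)
move=> x y /allpairsPdep[i [p [+ /allpairsP[[f g]] [/= + _ ->] ->]]].
rewrite mem_iota add0n => /= lt_in; rewrite mem_formulas_of_size ?(leq_trans lt_in) //.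
move=> /eqP szf /allpairsPdep[j [q [+ /allpairsP[[f' g']] [/= + _ ->] ->]]] /=.
rewrite mem_iota add0n => /= lt_jn; rewrite mem_formulas_of_size ?(leq_trans lt_jn) //.
by move=> /eqP szf' [Df <-]; move: szf' szf; rewrite -Df => -> [->].
Qed.

(** Resets the fuel left in a recursive call, so that sums over subformulas become coefficients of
    [formula_gf]. *)
Lemma perm_formulas_of_size d n :
  n <= d -> perm_eq (formulas_of_size d n) (formulas_of_size n n).
Proof.
move=> le_nd; apply: uniq_perm; rewrite ?formulas_of_size_uniq // => f.
by rewrite !mem_formulas_of_size.
Qed.

End FormulaEnum.

(** * Generating functions of weighted formulas *)

Section FormulaGF.
Context {V : finType} {R : comNzRingType}.
Implicit Types w u : formula V -> R.

Definition formula_gf w : fps R :=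
  FPS (fun n => \sum_(f <- formulas_of_size n n) w f).

Lemma formula_gfB w u :
  formula_gf (fun f => w f - u f) = formula_gf w - formula_gf u.
Proof. by apply: fpsP => n /=; rewrite sumrB. Qed.

(** This is the decomposition at the root: single leaves give the linear term, and each product of
    weights in [s], summed over all splittings of the leaves, gives a Cauchy product. *)
Lemma formula_gf_split (c : V -> R) (s : seq ((formula V -> R) * (formula V -> R))) w :
    (forall v, w (Var v) = c v) ->
    (forall f g, w (Imp f g) = \sum_(p <- s) p.1 f * p.2 g) ->
  formula_gf w =
    (\sum_v c v) *: fpsX R + \sum_(p <- s) formula_gf p.1 * formula_gf p.2.
Proof.
move=> wV wI; apply: fpsP => n.
have coef_sum (G : (formula V -> R) * (formula V -> R) -> fps R) :
  (\sum_(p <- s) G p) n = \sum_(p <- s) G p n.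
  by elim: s {wI} => [|p s IHs]; rewrite ?big_nil // !big_cons /= -IHs.
rewrite [RHS]/= coef_sum.
case: n coef_sum => [|n] _.
  rewrite /= big_nil mulr0 add0r big1 // => p _.
  by rewrite big_ord1 big_nil mulr0.
rewrite -[LHS]/(\sum_(f <- formulas_of_size n.+1 n.+1) w f) formulas_of_sizeS.
rewrite big_cat; congr (_ + _).
  case: eqP => [->|/eqP nz_n]; last by rewrite big_nil eqSS (negPf nz_n) mulr0.
  by rewrite big_map big_enum mulr1; apply: eq_bigr.
rewrite big_allpairs_dep -[in iota 0 n](subn0 n) -[iota 0 _]/(index_iota 0 n) big_mkord.
transitivity (\sum_(i < n) \sum_(p <- s)
    formula_gf p.1 i.+1 * formula_gf p.2 (n - i)%N).
  apply: eq_bigr => i _; rewrite big_allpairs.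
  transitivity (\sum_(p <- s) \sum_(f <- formulas_of_size n i.+1)
      \sum_(g <- formulas_of_size n (n - i)) p.1 f * p.2 g).
    rewrite [RHS]exchange_big; apply: eq_bigr => f _; rewrite [RHS]exchange_big.
    by apply: eq_bigr => g _; rewrite wI.
  apply: eq_bigr => p _ /=; rewrite big_distrl /=.
  rewrite (perm_big _ (perm_formulas_of_size (ltn_ord i))) /=.
  apply: eq_bigr => f _; rewrite big_distrr /=.
  by rewrite (perm_big _ (perm_formulas_of_size (leq_subr _ _))).
rewrite exchange_big; apply: eq_bigr => p _.
(* The two extreme terms of the Cauchy product vanish, because no formula has zero leaves. *)
rewrite [RHS]big_ord_recl big_ord_recr /= subnn !big_nil mul0r mulr0 add0r addr0.
by apply: eq_bigr.
Qed.

End FormulaGF.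

(** * Rows as formulas over truth values *)

Lemma true_rows_count n :
  true_rows n = count (fun f => eval id f == KTrue) (@formulas_of_size kleene n n).
Proof.
pose inst (r : bracketed n * {ffun 'I_n -> kleene}) := map_formula r.2 r.1.
(* The formulas agree because they have the same leaves and equal images; the assignments then agree
   because every variable occurs as a leaf. *)
have inst_inj : injective inst.
  move=> [f rho] [g tau]; rewrite /inst /= => eq_fg.
  have [lf lg] := (eqP (bformulaP f), eqP (bformulaP g)).
  have /val_inj-> : f = g :> formula _.
    by apply: map_formula_inj eq_fg _; rewrite lf lg.
  congr (_, _); apply/ffunP => i; have := congr1 (@leaves _) eq_fg.
  rewrite !leaves_map_formula lf lg => /eq_in_map; apply.
  by rewrite mem_enum.
rewrite /true_rows cardE -size_filter -(size_map inst).
apply: perm_size; apply: uniq_perm => [||f].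
- by rewrite map_inj_uniq ?enum_uniq.
- by rewrite filter_uniq ?formulas_of_size_uniq.
rewrite mem_filter mem_formulas_of_size //; apply/mapP/andP => [[r]|[Tf szf]].
  rewrite mem_enum inE => Tr ->; rewrite /inst eval_map_formula; split=> //.
  by rewrite leaves_map_formula size_map (eqP (bformulaP _)) size_enum_ord.
(* Conversely, the assignment is read off the leaves of [f], and [formula_relabel] supplies the
   bracketing. *)
pose rho := [ffun i : 'I_n => nth KTrue (leaves f) i].
have [|g lg Dg] := @formula_relabel _ _ rho f (enum 'I_n).
  apply: (@eq_from_nth _ KTrue); rewrite size_map size_enum_ord ?(eqP szf) //.
  move=> i lt_in; rewrite (nth_map (Ordinal lt_in)) ?size_enum_ord //.
  by rewrite ffunE nth_enum_ord.
have brg : is_bracketed g by apply/eqP.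
exists (Bracketed brg, rho); last by rewrite /inst /= Dg.
by rewrite mem_enum inE -[eval _ _]/(eval (id \o rho) g) -eval_map_formula Dg.
Qed.

(** Once the lower coefficients of [g] are known to vanish, the coefficient of index [n] in [f * g]
    is [f 0 * g n]. This serves to cancel [1 - A], whose constant term is 1. *)
Lemma fps_mulfI (R : idomainType) (f g : fps R) : f 0%N != 0 -> f * g = 0 -> g = 0.
Proof.
move=> nz_f fg0; apply: fpsP => n; elim/ltn_ind: n => n IHn.
have /eqP := congr1 (fun h : fps R => h n) fg0.
rewrite /= big_ord_recl subn0 big1 => [|i _].
  by rewrite addr0 mulf_eq0 (negPf nz_f) => /eqP.
rewrite IHn ?mulr0 //= /bump add1n.
by case: n i {IHn} => [[]|n i] //; rewrite ltnS subSS leq_subr.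
Qed.

(** * The functional equations and their elimination *)

Section KleeneGF.

Let truth_gf (a : kleene) : fps rat :=
  formula_gf (fun f => (eval id f == a)%:R).
Let A : fps rat := formula_gf (fun _ : formula kleene => 1).
Let x := fpsX rat.

Lemma sum_kleene (c : kleene -> rat) :
  \sum_v c v = c KFalse + c KTrue + c KUnknown.
Proof.
rewrite (bigD1 KFalse) //= (bigD1 KTrue) //= (bigD1 KUnknown) //= big1 ?addr0 ?addrA //.
by case.
Qed.

Lemma all_rows_gfE : A = 3%:R * x + A ^+ 2.
Proof.
rewrite {1}/A (@formula_gf_split _ _ (fun=> 1) [:: (fun=> 1, fun=> 1)]) //=.
  by rewrite sum_kleene big_seq1 mulr_natl -scaler_nat expr2.
by move=> f g; rewrite big_seq1 mulr1.
Qed.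

(** An implication is false only when its premise is true and its conclusion false. *)
Lemma false_rows_gfE : truth_gf KFalse = x + truth_gf KTrue * truth_gf KFalse.
Proof.
rewrite {1}/truth_gf (@formula_gf_split _ _ (fun v => (v == KFalse)%:R)
  [:: (fun f => (eval id f == KTrue)%:R, fun f => (eval id f == KFalse)%:R)]) //=.
  by rewrite sum_kleene big_seq1 scale1r.
by move=> f g; rewrite big_seq1 /=; do 2!case: eval.
Qed.

(** An implication is true in two disjoint cases: the premise is false and the conclusion arbitrary,
    or the premise is not false and the conclusion is true. *)
Lemma true_rows_gfE :
  truth_gf KTrue =
    x + truth_gf KFalse * A + (A - truth_gf KFalse) * truth_gf KTrue.
Proof.
rewrite {1}/truth_gf (@formula_gf_split _ _ (fun v => (v == KTrue)%:R)
  [:: (fun f => (eval id f == KFalse)%:R, fun=> 1);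
      (fun f => 1 - (eval id f == KFalse)%:R, fun f => (eval id f == KTrue)%:R)]) //=.
  by rewrite sum_kleene big_cons big_seq1 scale1r formula_gfB addrA.
by move=> f g; rewrite big_cons big_seq1 /=; do 2!case: eval.
Qed.

Lemma true_rows_gf_truth : true_rows_gf = truth_gf KTrue.
Proof.
apply: fpsP => -[|n]; first by rewrite /= big_nil.
rewrite [LHS]/= true_rows_count -sum1_count natr_sum big_mkcond.
by apply: eq_bigr => f _; case: eqP.
Qed.

Lemma true_rows_quadratic :
  3%:R * true_rows_gf * (1 - true_rows_gf) = A * (1 + A - 2%:R * true_rows_gf).
Proof.
rewrite true_rows_gf_truth; set T := truth_gf KTrue.
set F := truth_gf KFalse; set y := x.
have [[eA eF] eT] : (A = 3%:R * y + A ^+ 2) * (F = y + T * F) *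
  (T = y + F * A + (A - F) * T) := (all_rows_gfE, false_rows_gfE, true_rows_gfE).
apply/eqP; rewrite -subr_eq0; apply/eqP; apply: (@fps_mulfI _ (1 - A)).
  by rewrite /= big_nil subr0.
(* Multiplying the equation for T by 1 - T turns F (1 - T) into x. *)
transitivity (3%:R * (1 - T) * (T - (y + F * A + (A - F) * T))
    + 3%:R * (A - T) * (F - (y + T * F))
    - (1 + A - 2%:R * T) * (A - (3%:R * y + A ^+ 2))).
  by move: A T F y {eA eF eT} => A' T' F' y'; ring.
by rewrite -eT -eF -eA !subrr !mulr0 subr0 addr0.
Qed.

(** Completing the square in [A - A ^+ 2 = 3x] gives this root; its constant term is 1 since [A] has
    none. *)
Lemma sqrt_all_rows : fps_sqrt 1 (1 - 12%:R * x) = 1 - 2%:R * A.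
Proof.
apply: fps_sqrt_uniq => //.
  transitivity (1 - 12%:R * x - 4%:R * (A - (3%:R * x + A ^+ 2))).
    by move: A x => A' x'; ring.
  by rewrite -all_rows_gfE subrr mulr0 subr0.
by rewrite /= big_ord1 /= big_nil mulr0 subr0.
Qed.

End KleeneGF.

Theorem corollary5 :
  let x := fpsX rat in
  let r := fps_sqrt 1 (1 - 12%:R * x) in
  true_rows_gf =
    (6%:R : rat)^-1 *: (4%:R - r - fps_sqrt 3%:R (5%:R + 24%:R * x + 4%:R * r)).
Proof.
move=> x r; rewrite /r sqrt_all_rows; set A := formula_gf _.
have eA : A = 3%:R * x + A ^+ 2 := all_rows_gfE.
have eT := true_rows_quadratic; rewrite -/A in eT.
set T := true_rows_gf in eT *.
(* As a quadratic in [T], the relation reads [3 T^2 - (3 + 2 A) T + A + A^2 = 0]. Completing the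
   square gives [(3 + 2 A - 6 T)^2 = 9 - 8 A^2], and the constant term 3 fixes the sign. *)
rewrite (@fps_sqrt_uniq _ _ _ (3%:R + 2%:R * A - 6%:R * T)) //.
- rewrite (_ : _ - _ = 6%:R * T); last by move: A T {eA eT} => A T; ring.
  by rewrite mulr_natl -scaler_nat scalerA mulVf // scale1r.
(* The factor 8 trades [24 x] for [8 (A - A^2)], which turns the radicand into [9 - 8 A^2]; the
   factor 12 is four times the leading coefficient 3. *)
- transitivity (5%:R + 24%:R * x + 4%:R * (1 - 2%:R * A)
      + 8%:R * (A - (3%:R * x + A ^+ 2))
      - 12%:R * (3%:R * T * (1 - T) - A * (1 + A - 2%:R * T))).
    by move: A T x {r eA eT} => A T x; ring.
  by rewrite -eA eT !subrr !mulr0 addr0 subr0.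
by rewrite /= !big_ord1 /= big_nil !mulr0 addr0 subr0.
Qed.
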